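(* Let $X$ be a Baire space, $Y$ a topological space, $(Z,d)$ a metric space, and $f:X\times Y\to Z$ a mapping. Let $\mathcal L$ be a collection of nonempty subsets of $Y$ such that for every $y\in Y$ Player I has a winning strategy in the game $G(\mathcal L,y)$ on $Y$. Suppose that $f$ is horizontally quasicontinuous, that $f^y$ is cliquish for every $y\in Y$, and that $f_x$ is fragmentable for each $x\in X$. Then $f$ is cliquish in each of the following cases: (i) $\mathcal L=\mathcal O(Y)$; (ii) $\mathcal L=\mathcal A(Y)$, $f^y$ is quasicontinuous for every $y\in Y$, and $f$ is lower quasicontinuous with respect to the variable $y$.
   Context: No separation axioms are assumed on topological spaces. Sections: for $f:X\times Y\to Z$, $x\in X$, $y\in Y$, put $f_x:Y\to Z$, $f_x(y)=f(x,y)$, and $f^y:X\to Z$, $f^y(x)=f(x,y)$. A mapping $g:T\to Z$ from a topological space $T$ to a metric space $(Z,d)$ is cliquish if for any $\varepsilon>0$ and any nonempty open $U\subset T$ there is a nonempty open $O\subset U$ with $d(g(s),g(t))<\varepsilon$ for all $s,t\in O$. It is fragmentable if the restriction of $g$ to each nonempty subspace of $T$ is cliquish. It is quasicontinuous if for every $\varepsilon>0$, every $t\in T$ and every neighborhood $V$ of $t$ there is a nonempty open set $O\subset V$ with $d(g(t),g(s))<\varepsilon$ for each $s\in O$. $f$ is horizontally quasicontinuous at $(a,b)\in X\times Y$ if for every neighborhood $W$ of $f(a,b)$ in $Z$ and every neighborhood $U\times V$ of $(a,b)$ in $X\times Y$ there are a nonempty open set $O\subset U$ and $y\in V$ such that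 $f(O\times\{y\})\subset W$. $f$ is lower quasicontinuous with respect to the variable $y$ at $(a,b)$ if for every neighborhood $W$ of $f(a,b)$ and every neighborhood $U\times V$ of $(a,b)$ there is a nonempty open set $O\subset V$ such that for each $y\in O$ there is $x\in U$ with $f(x,y)\in W$. When no point is specified, the property is required at every point of $X\times Y$. $\mathcal O(Y)$ is the collection of all nonempty open subsets of $Y$; $\mathcal A(Y)$ is the collection of all somewhere dense subsets of $Y$, i.e. those $F\subset Y$ with $\mathrm{Int}(\overline F)\neq\emptyset$. Game $G(\mathcal L,y)$ on $Y$ (for a collection $\mathcal L$ of nonempty subsets of $Y$ and $y\in Y$): at each stage $n=0,1,2,\dots$ Player I chooses $L_n\in\mathcal L$ and then Player II chooses a point $y_n\in L_n$. Player I wins the play if $y\in\overline{\{y_n:n\in\mathbb N\}}$; otherwise Player II wins. A strategy for Player I is a map $\tau$ assigning to each finite sequence in $Y$ (including the empty one) a member of $\mathcal L$; it is winning if $y\in\overline{\{y_n:n\in\mathbb N\}}$ for every sequence $(y_n)$ with $y_0\in\tau(\emptyset)$ and $y_{n+1}\in\tau(y_0,\dots,y_n)$ for all $n$. *)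

(* Defs.v *)
From HB Require Import structures.
From mathcomp Require Import all_boot all_order all_algebra.
From mathcomp Require Import all_classical reals topology.

Set Implicit Arguments.
Unset Strict Implicit.
Unset Printing Implicit Defensive.

Import Order.TTheory GRing.Theory Num.Theory.

Local Open Scope classical_set_scope.
Local Open Scope ring_scope.

Definition baire_space (X : topologicalType) : Prop :=
  forall F : nat -> set X, (forall n, open (F n) /\ dense (F n)) ->
    dense (\bigcap_n F n).

Definition vsection {X Y Z : Type} (f : X * Y -> Z) (x : X) : Y -> Z :=
  fun y => f (x, y).

Definition hsection {X Y Z : Type} (f : X * Y -> Z) (y : Y) : X -> Z :=
  fun x => f (x, y).

Section single_variable.
Context {R : realType} {T : topologicalType} {Z : metricType R}.
Implicit Type g : T -> Z.

Definition cliquish g : Prop :=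
  forall (e : R) (U : set T), 0 < e -> open U -> U !=set0 ->
    exists O : set T, [/\ open O, O !=set0, O `<=` U &
      forall s t, O s -> O t -> mdist (g s) (g t) < e].

Definition quasicontinuous g : Prop :=
  forall (e : R) (t : T) (V : set T), 0 < e -> nbhs t V ->
    exists O : set T, [/\ open O, O !=set0, O `<=` V &
      forall s, O s -> mdist (g t) (g s) < e].

End single_variable.

(* [sigL A g] lives on the sigma type [set_type A], which carries the induced
   topology; [subspace A] would instead be a topology on all of [T] in which
   the points outside [A] are isolated. *)
Definition fragmentable {R : realType} {T : topologicalType} {Z : metricType R}
    (g : T -> Z) : Prop :=
  forall A : set T, A !=set0 -> cliquish (sigL A g).

Section two_variables.
Context {X Y Z : topologicalType}.
Implicit Type f : X * Y -> Z.

Definition horizontally_quasicontinuous_at f (a : X) (b : Y) : Prop :=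
  forall (W : set Z) (U : set X) (V : set Y),
    nbhs (f (a, b)) W -> nbhs a U -> nbhs b V ->
    exists (O : set X) (y : Y), [/\ open O, O !=set0, O `<=` U, V y &
      f @` (O `*` [set y]) `<=` W].

Definition horizontally_quasicontinuous f : Prop :=
  forall a b, horizontally_quasicontinuous_at f a b.

Definition lower_quasicontinuous_snd_at f (a : X) (b : Y) : Prop :=
  forall (W : set Z) (U : set X) (V : set Y),
    nbhs (f (a, b)) W -> nbhs a U -> nbhs b V ->
    exists O : set Y, [/\ open O, O !=set0, O `<=` V &
      forall y, O y -> exists2 x, U x & W (f (x, y))].

Definition lower_quasicontinuous_snd f : Prop :=
  forall a b, lower_quasicontinuous_snd_at f a b.

End two_variables.

Definition nonempty_opens (Y : topologicalType) : set (set Y) :=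
  [set L | open L /\ L !=set0].
Arguments nonempty_opens : clear implicits.

Definition somewhere_dense_sets (Y : topologicalType) : set (set Y) :=
  [set F | interior (closure F) !=set0].
Arguments somewhere_dense_sets : clear implicits.

Section game.
Context {Y : topologicalType}.
Implicit Types (calL : set (set Y)) (tau : seq Y -> set Y) (y : Y).

Definition is_strategy calL tau : Prop := forall s : seq Y, calL (tau s).

(* [mkseq u n] is the history [:: u 0; ...; u n.-1] before stage [n]. *)
Definition winning_strategy tau y : Prop :=
  forall u : nat -> Y, (forall n, tau (mkseq u n) (u n)) ->
    closure (range u) y.

Definition playerI_wins calL y : Prop :=
  exists2 tau, is_strategy calL tau & winning_strategy tau y.

End game.

(* Main.v *)
Require Import Defs.
From HB Require Import structures.
From mathcomp Require Import all_boot all_order all_algebra.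
From mathcomp Require Import all_classical reals topology.
From mathcomp Require Import lra.

Import Order.TTheory GRing.Theory Num.Theory.

(** If [f] is not cliquish, there are [e > 0] and an open rectangle
    [U0 `*` V0] such that [f] oscillates by at least [e] on every nonempty open
    subset of [U0 `*` V0]. The contradiction comes from a single section [f_x]
    with [x] in [U0] and a countable set [A] included in [V0]: every point [q]
    of [A] is a limit of points [q'] of [A] with
    [e / 4 <= d (f (x, q)) (f (x, q'))], so that the restriction of [f_x] to
    [A] is not cliquish, against fragmentability.

    The points of [A] form a tree in which every node has countably many
    children. The children of [q] are the answers of Player II, in order, to a
    winning strategy of Player I in the game at [q]; hence [q] is in their
    closure. Player II has to answer a move [L] with a point at which [f] is far
    from its values at [q]. If [L] is not included in [V0], any point of [L]
    outside [V0] will do, since such a point is not kept in [A]. If [L] is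
    included in [V0], shrink the current open [U] in [X] so that [f] is almost
    constant on [U `*` [set q]]; as [f] oscillates on [U `*` V'] for all open
    [V'] in [V0], some value of [f] there is far from this constant, and it can
    be approximated on [O `*` [set y]] for some [y] in [L] and some open [O] in
    [U] ([separate_from_section]). The last step is where the two cases differ:
    for [L] open it is horizontal quasicontinuity; for [L] somewhere dense,
    lower quasicontinuity moves to a point over [L] and quasicontinuity of the
    horizontal section spreads the value over an open set.

    Each answer is thus correct only for [x] in some open subset of [U], while
    infinitely many answers are needed for the same [x]. Choosing them along a
    decreasing sequence of open sets would not do, since in a Baire space its
    intersection may be empty; instead the choices are organized into locally
    constant functions of [x], each defined on a dense open set
    ([baire_strategy]). *)

(** * Dependent choices at the points of a Baire space *)

Local Open Scope classical_set_scope.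
Local Open Scope ring_scope.

(** Partial maps from [T] to [S] are represented by their graphs, so that a
    chain of them, ordered by extension, is bounded by its union. *)
Definition dense_locally_constant {T : topologicalType} {S : Type}
    (G : set (T * S)) : Prop :=
  [/\ forall x s s', G (x, s) -> G (x, s') -> s = s',
      forall x s, G (x, s) -> \forall x' \near x, G (x', s)
    & dense [set x | exists s, G (x, s)]].

Lemma dense_locally_constant_open_dom {T : topologicalType} {S : Type}
    (G : set (T * S)) :
  dense_locally_constant G -> open [set x | exists s, G (x, s)].
Proof.
move=> [_ Gloc _]; rewrite openE => x /= [s Gxs].
by apply: filterS (Gloc _ _ Gxs) => x' Gx's; exists s.
Qed.

(** A maximal locally constant partial selection exists by Zorn's lemma. Its
    domain is dense: if the open set [U] missed it, the selection could be
    extended by a constant on a nonempty open subset of [U]. *)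
Lemma locally_constant_selection {T : topologicalType} {S : Type}
    (Q : T -> S -> Prop) :
  (forall U : set T, open U -> U !=set0 -> exists (s : S) (O : set T),
    [/\ open O, O !=set0, O `<=` U & forall x, O x -> Q x s]) ->
  exists G : set (T * S),
    dense_locally_constant G /\ forall x s, G (x, s) -> Q x s.
Proof.
move=> hQ.
pose P (G : set (T * S)) := [/\ forall x s, G (x, s) -> Q x s,
  forall x s s', G (x, s) -> G (x, s') -> s = s' &
  forall x s, G (x, s) -> \forall x' \near x, G (x', s)].
have [F FP Ftot|G [[GQ Gfun Gloc] Gmax]] := @Zorn_bigcup _ P.
  split.
  - by move=> x s [G FG Gxs]; have [GQ _ _] := FP _ FG; apply: GQ.
  - move=> x s s' [G FG Gxs] [G' FG' Gxs'].
    have [_ Gfun _] := FP _ FG; have [_ Gfun' _] := FP _ FG'.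
    have [sub|sub] := Ftot _ _ FG FG'.
      by apply: (Gfun' x) => //; apply: sub.
    by apply: (Gfun x) => //; apply: sub.
  - move=> x s [G FG Gxs]; have [_ _ Gloc] := FP _ FG.
    by apply: filterS (Gloc _ _ Gxs) => x' Gx's; exists G.
exists G; split => //; split => // U U0 oU; apply: contrapT => Udisj.
have nG x s : U x -> ~ G (x, s).
  by move=> Ux Gxs; apply: Udisj; exists x; split => //; exists s.
have [s0 [O [oO [x0 Ox0] OU OQ]]] := hQ U oU U0.
pose G' := G `|` [set xs | O xs.1 /\ xs.2 = s0].
apply: (Gmax G').
  split; first exact: subsetUl.
  by move=> /(_ (x0, s0)) /(_ (or_intror (conj Ox0 erefl))); apply/nG/OU.
split.
- by move=> x s [/GQ //|/= [Ox ->]]; apply: OQ.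
- move=> x s s' [Gxs|/= [Ox ->]] [Gxs'|/= [Ox' ->]] //.
  + exact: (Gfun x).
  + by exfalso; apply: nG Gxs; apply: OU.
  + by exfalso; apply: nG Gxs'; apply: OU.
- move=> x s [/Gloc|/= [Ox ->]].
    by apply: filterS => x' ?; left.
  by apply: filterS (open_nbhs_nbhs (conj oO Ox)) => x' ?; right.
Qed.

(** One half of Oxtoby's theorem on the Banach-Mazur (Choquet) game: in a Baire
    space the player who moves first cannot force an empty intersection.
    Here [h] is the record of the earlier choices. The records of length [n]
    are chosen as a locally constant function of [x] on a dense open set; at a
    point common to all these sets the records extend one another. *)
Lemma baire_strategy {X : topologicalType} {S : Type}
    (P : seq S -> S -> X -> Prop) :
  baire_space X ->
  (forall (h : seq S) (U : set X), open U -> U !=set0 ->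
    exists (s : S) (O : set X),
      [/\ open O, O !=set0, O `<=` U & forall x, O x -> P h s x]) ->
  dense [set x | exists u : nat -> S, forall n, P (mkseq u n) (u n) x].
Proof.
move=> baireX hP.
pose extends (G G' : set (X * seq S)) := forall x h, G' (x, h) ->
  exists h' s, [/\ G (x, h'), h = rcons h' s & P h' s x].
have /choice[next nextP] : forall G : set (X * seq S), exists G',
    dense_locally_constant G -> dense_locally_constant G' /\ extends G G'.
  move=> G; have [dG|] := pselect (dense_locally_constant G); last by exists G.
  have [_ Gloc Gdense] := dG.
  pose Q x h := exists h' s, [/\ G (x, h'), h = rcons h' s & P h' s x].
  have [|G' [dG' G'Q]] := @locally_constant_selection X (seq S) Q.
    move=> U oU U0; have [x0 [Ux0 [h Gx0h]]] := Gdense _ U0 oU.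
    have [||s [O [oO O0 OU OP]]] := hP h (U `&` interior [set x | G (x, h)]).
    - by apply: openI => //; apply: open_interior.
    - by exists x0; split => //; exact: (Gloc _ _ Gx0h).
    exists (rcons h s), O; split => //.
      by move=> x /OU [].
    move=> x Ox; exists h, s; split => //; last exact: OP.
    by have [_ /interior_subset] := OU _ Ox.
  by exists G'.
pose G n := iter n next [set xh | xh.2 = [::]].
have dG n : dense_locally_constant (G n).
  elim: n => [|n /nextP[]//].
  split=> /= [x s s' -> -> //|x s ->|]; first exact: filterE.
  by move=> O [x Ox] _; exists x; split => //; exists [::].
have extG n : extends (G n) (G n.+1) by have [] := nextP _ (dG n).
have dom_dense := baireX (fun n => [set x | exists h, G n (x, h)]).
move=> O O0 oO.
have [|x [Ox Gx]] := dom_dense _ O O0 oO.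
  move=> n; split; first exact: dense_locally_constant_open_dom.
  by have [] := dG n.
exists x; split => //.
have /choice[h hG] : forall n, exists h, G n (x, h) by move=> n; apply: Gx.
have /choice[u uP] : forall n, exists s, h n.+1 = rcons (h n) s /\ P (h n) s x.
  move=> n; have [h' [s [Gh' hE Phs]]] := extG n _ _ (hG n.+1).
  have [Gfun _ _] := dG n.
  by exists s; rewrite (Gfun _ _ _ (hG n) Gh').
have hE n : h n = mkseq u n.
  elim: n => [|n IH]; first exact: (hG 0%N).
  by rewrite mkseqS -IH; have [] := uP n.
by exists u => n; rewrite -hE; have [] := uP n.
Qed.

(** * Approximating values of f over prescribed subsets of Y *)

Lemma open_rectangle {X Y : topologicalType} (U : set X) (V : set Y) :
  open U -> open V -> open (U `*` V).
Proof.
move=> oU oV; rewrite openE => -[x y] /= [Ux Vy].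
by exists (U, V) => //; split; apply: open_nbhs_nbhs.
Qed.

Lemma nbhs_mdist_lt {R : realType} {Z : metricType R} (z : Z) (e : R) :
  0 < e -> nbhs z [set w | mdist z w < e].
Proof. by move=> e0; rewrite -ballEmdist; apply: nbhsx_ballx. Qed.

(** What the argument needs of a move [L] of Player I: values of [f] over [V]
    are approximated, uniformly on open subsets of [X], at single points of
    [L]. *)
Definition horizontally_approaches {R : realType} {X Y : topologicalType}
    {Z : metricType R} (f : X * Y -> Z) (L V : set Y) : Prop :=
  forall (e : R) (U : set X) (a : X) (b : Y), 0 < e -> open U -> U a -> V b ->
    exists (y : Y) (O : set X), [/\ L y, open O, O !=set0, O `<=` U &
      forall x, O x -> mdist (f (a, b)) (f (x, y)) < e].

Section horizontal_approximation.
Context {R : realType} {X Y : topologicalType} {Z : metricType R}.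
Context (f : X * Y -> Z).

Lemma open_horizontally_approaches (V : set Y) :
  horizontally_quasicontinuous f -> open V -> horizontally_approaches f V V.
Proof.
move=> hf oV e U a b e0 oU Ua Vb.
have [O [y [oO O0 OU Vy fO]]] := hf a b _ _ _ (nbhs_mdist_lt (f (a, b)) e e0)
  (open_nbhs_nbhs (conj oU Ua)) (open_nbhs_nbhs (conj oV Vb)).
exists y, O; split => // x Ox.
by apply: (fO (f (x, y))); exists (x, y).
Qed.

(** Lower quasicontinuity yields an open set of [y] over which the value is
    nearly attained; this set meets [L], and quasicontinuity of the horizontal
    section at a point of [L] turns one such value into an open set of them. *)
Lemma dense_horizontally_approaches (L V : set Y) :
  (forall y, quasicontinuous (hsection f y)) ->
  lower_quasicontinuous_snd f ->
  open V -> V `<=` closure L -> horizontally_approaches f L V.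
Proof.
move=> hq hl oV VL e U a b e0 oU Ua Vb.
have e2 : 0 < e / 2 by lra.
have [O [oO [y0 Oy0] OV fO]] := hl a b _ _ _
  (nbhs_mdist_lt (f (a, b)) (e / 2) e2)
  (open_nbhs_nbhs (conj oU Ua)) (open_nbhs_nbhs (conj oV Vb)).
have [y [Ly Oy]] := VL _ (OV _ Oy0) O (open_nbhs_nbhs (conj oO Oy0)).
have [x Ux /= fxy] := fO _ Oy.
have [N [oN N0 NU fN]] := hq y (e / 2) x U e2 (open_nbhs_nbhs (conj oU Ux)).
exists y, N; split => // t Nt.
have := fN _ Nt; rewrite /hsection.
by have := metric_triangle (f (a, b)) (f (x, y)) (f (t, y)); lra.
Qed.

(** The section at [p] varies by less than [e / 8] on some open [U'], whereas
    two values of [f] on [U' `*` V] are [e] apart; so one of them is at distance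
    [e / 2] from a value of the section. Approximating it up to [e / 8] over [L]
    leaves [e / 2 - e / 8 - e / 8 = e / 4]. *)
Lemma separate_from_section (e : R) (U : set X) (L V : set Y) (p : Y) :
  (forall y, cliquish (hsection f y)) -> 0 < e ->
  (forall O : set (X * Y), open O -> O !=set0 -> O `<=` U `*` V ->
    exists s t, [/\ O s, O t & e <= mdist (f s) (f t)]) ->
  horizontally_approaches f L V ->
  open U -> U !=set0 -> open V -> V !=set0 ->
  exists (y : Y) (O : set X), [/\ L y, open O, O !=set0, O `<=` U &
    forall x, O x -> e / 4 <= mdist (f (x, p)) (f (x, y))].
Proof.
move=> hc e0 fbad LV oU U0 oV [b0 Vb0].
have e8 : 0 < e / 8 by lra.
have [U' [oU' [x0 U'x0] U'U fU']] := hc p (e / 8) U e8 oU U0.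
have [a [b [U'a Vb far]]] : exists a b,
    [/\ U' a, V b & e / 2 <= mdist (f (x0, p)) (f (a, b))].
  have [|||[a b] [[a' b'] [[/= U'a Vb] [/= U'a' Vb'] far]]] :=
      fbad (U' `*` V).
  - exact: open_rectangle.
  - by exists (x0, b0).
  - by move=> [? ?] /= []; split => //; apply: U'U.
  have := metric_triangle (f (a, b)) (f (x0, p)) (f (a', b')).
  rewrite (metric_sym (f (a, b)) (f (x0, p))) => tri.
  have [close|?] := ltP (mdist (f (x0, p)) (f (a, b))) (e / 2).
    by exists a', b'; split => //; lra.
  by exists a, b.
have [y [O [Ly oO O0 OU' fO]]] := LV (e / 8) U' a b e8 oU' U'a Vb.
exists y, O; split => //; first exact: subset_trans U'U.
move=> x Ox.
have := fO x Ox; have := fU' x0 x U'x0 (OU' _ Ox); rewrite /hsection.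
have := metric_triangle (f (x0, p)) (f (x, p)) (f (a, b)).
have := metric_triangle (f (x, p)) (f (x, y)) (f (a, b)).
by rewrite (metric_sym (f (x, y)) (f (a, b))); lra.
Qed.

End horizontal_approximation.

(** * Numbering the nodes of the tree *)

(** Since every positive integer is uniquely [2 ^ p * (2 k + 1)], each node
    [m > 0] is the [k]-th child of exactly one node [p]. Moreover [p] and the
    earlier children of [p] precede [m], so they are known when the point
    numbered [m] is chosen. *)
Definition child (p k : nat) : nat := (2 ^ p * k.*2.+1)%N.
Definition parent (m : nat) : nat := logn 2 m.
Definition rank (m : nat) : nat := (m %/ 2 ^ parent m)./2.

Lemma parent_child p k : parent (child p k) = p.
Proof.
rewrite /parent /child lognM ?expn_gt0// pfactorK//.
by rewrite lognE /= dvdn2 /= odd_double addn0.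
Qed.

Lemma rank_child p k : rank (child p k) = k.
Proof.
by rewrite /rank parent_child /child mulKn ?expn_gt0// -uphalfE uphalf_double.
Qed.

Lemma child_gt0 p k : (0 < child p k)%N.
Proof. by rewrite muln_gt0 expn_gt0. Qed.

Lemma parent_lt p k : (p < child p k)%N.
Proof. by rewrite /child (leq_trans (@ltn_expl 2 p _))// leq_pmulr. Qed.

Lemma child_mono p j k : (j < k)%N -> (child p j < child p k)%N.
Proof. by move=> jk; rewrite ltn_pmul2l ?expn_gt0// ltnS ltn_double. Qed.

Definition child_history {T : Type} (u : nat -> T) (m : nat) : seq T :=
  mkseq (fun j => u (child (parent m) j)) (rank m).

Lemma child_history_mkseq {T : Type} (x0 : T) (u : nat -> T) p k :
  child_history (nth x0 (mkseq u (child p k))) (child p k) =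
  mkseq (fun j => u (child p j)) k.
Proof.
rewrite /child_history parent_child rank_child; apply/eq_in_map => j.
by rewrite mem_iota => jk; rewrite nth_mkseq// child_mono.
Qed.

(** * The tree of plays *)

(** The hypothesis on moves [L] that are included in an open [V] is all that the
    two cases have to provide. *)
Lemma cliquish_of_approachable_moves {R : realType} {X Y : topologicalType}
    {Z : metricType R} (f : X * Y -> Z) (calL : set (set Y)) :
  baire_space X ->
  (forall L : set Y, calL L -> L !=set0) ->
  (forall y : Y, playerI_wins calL y) ->
  (forall y : Y, cliquish (hsection f y)) ->
  (forall x : X, fragmentable (vsection f x)) ->
  (forall L V : set Y, calL L -> open V -> L `<=` V ->
    exists V', [/\ open V', V' !=set0, V' `<=` V
                 & horizontally_approaches f L V']) ->
  cliquish f.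
Proof.
move=> hX hL hgame hfy hfx happ e W e0 oW [[a0 b0] Wab].
apply: contrapT => nocliquish.
have fbad (O : set (X * Y)) : open O -> O !=set0 -> O `<=` W ->
    exists s t, [/\ O s, O t & e <= mdist (f s) (f t)].
  move=> oO O0 OW; apply: contrapT => nO; apply: nocliquish.
  exists O; split => // s t Os Ot; rewrite ltNge; apply/negP => le_e.
  by apply: nO; exists s, t.
have [U0 [V0 [oU0 U0a oV0 V0b UVW]]] : exists (U0 : set X) (V0 : set Y),
    [/\ open U0, U0 a0, open V0, V0 b0 & U0 `*` V0 `<=` W].
  have [[A B] [/= nA nB] ABW] : nbhs (a0, b0) W by apply: open_nbhs_nbhs.
  exists (interior A), (interior B); split => //; try exact: open_interior.
  by move=> [x y] [/= Ax By]; apply: ABW; split; apply: interior_subset.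
have /choice[tau tauP] : forall y, exists tau,
    is_strategy calL tau /\ winning_strategy tau y.
  by move=> y; have [tau] := hgame y; exists tau.
(* The answer of Player I, in the game at the parent of the next node, to the
   siblings chosen so far. *)
pose move_at (h : seq Y) :=
  tau (nth b0 h (parent (size h))) (child_history (nth b0 h) (size h)).
(* Requiring separation only for x in U0 lets the density form of
   [baire_strategy] be used on the whole space, and only for y in V0 makes
   answers outside V0 harmless. *)
pose good (h : seq Y) (y : Y) (x : X) :=
  if h is [::] then V0 y
  else move_at h y /\ (U0 x -> V0 y ->
    e / 4 <= mdist (f (x, nth b0 h (parent (size h)))) (f (x, y))).
have [h U oU Une|x [U0x [u uP]]] :=
    @baire_strategy X Y good hX _ U0 (ex_intro _ a0 U0a) oU0.
  case E: h => [|y0 h0].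
    by exists b0, U; split.
  rewrite -E /good E -E; set p := nth _ _ _.
  have calLm : calL (move_at h) by apply: (tauP _).1.
  have [y1 Ly1] := hL _ calLm.
  have [[x1 [Ux1 U0x1]]|UU0] := pselect ((U `&` U0) !=set0); last first.
    exists y1, U; split => // x Ux; split => // U0x.
    by exfalso; apply: UU0; exists x.
  have [LV|/existsNP[y2 /not_implyP[Ly2 nVy2]]] :=
      pselect (move_at h `<=` V0); last by exists y2, U; split.
  have [V' [oV' V'0 V'V LV']] := happ _ _ calLm oV0 LV.
  have [|||y [O [Ly oO O0 OU far]]] :=
    @separate_from_section R X Y Z f e (U `&` U0) (move_at h) V' p hfy e0 _ LV'
      _ _ oV' V'0.
  - move=> O oO O0 OUV; apply: fbad => //.
    by move=> xy /OUV[[_ ?] ?]; apply: UVW; split => //; apply: V'V.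
  - exact: openI.
  - by exists x1.
  exists y, O; split => //; first by move=> x /OU[].
  by move=> x Ox; split => // _ _; apply: far.
have u0V : V0 (u 0%N) := uP 0%N.
have childP p k : tau (u p) (mkseq (fun j => u (child p j)) k) (u (child p k))
    /\ (V0 (u (child p k)) ->
        e / 4 <= mdist (f (x, u p)) (f (x, u (child p k)))).
  have := uP (child p k); have := child_history_mkseq b0 u p k.
  have := nth_mkseq b0 u (parent_lt p k).
  have := size_mkseq u (child p k); have := child_gt0 p k.
  rewrite /good /move_at; case: (mkseq u (child p k)) => [+ sz|y h].
    by rewrite -sz.
  move=> _ ->; rewrite parent_child => -> -> [? far].
  by split => //; apply: far.
pose A := range u `&` V0.
have A0 : A !=set0 by exists (u 0%N); split => //; exists 0%N.
have e4 : 0 < e / 4 by lra.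
have AT : [set: set_type A] !=set0.
  by case: A0 => y Ay; exists (SigSub (mem_set Ay)).
have [_ [[O' oO' <-] [t O't] _ small]] := hfx x A A0 (e / 4) setT e4 openT AT.
have [[p _ up] Vt] : A (val t) := set_valP t.
have [_ [[k _ <-] [O'k Vk]]] : exists y,
    range (fun k => u (child p k)) y /\ (O' `&` V0) y.
  apply: (proj2 (tauP (u p)) (fun k => u (child p k))).
    by move=> k; have [] := childP p k.
  by apply: open_nbhs_nbhs; split; [apply: openI|rewrite up].
have Ak : A (u (child p k)) by split => //; exists (child p k).
have : mdist (f (x, u p)) (f (x, u (child p k))) < e / 4.
  by rewrite up; exact: (small t (SigSub (mem_set Ak)) O't O'k).
by rewrite ltNge => /negP; apply; have [_ ->] := childP p k.
Qed.

Theorem theorem3p4 (R : realType) (X Y : topologicalType) (Z : metricType R)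
    (f : X * Y -> Z) (calL : set (set Y))
    (hX : baire_space X)
    (hL : forall L : set Y, calL L -> L !=set0)
    (hgame : forall y : Y, playerI_wins calL y)
    (hf : horizontally_quasicontinuous f)
    (hfy : forall y : Y, cliquish (hsection f y))
    (hfx : forall x : X, fragmentable (vsection f x)) :
  (calL = nonempty_opens Y -> cliquish f) /\
  (calL = somewhere_dense_sets Y ->
   (forall y : Y, quasicontinuous (hsection f y)) ->
   lower_quasicontinuous_snd f -> cliquish f).
Proof.
split=> [calLE|calLE hq hl];
    apply: (cliquish_of_approachable_moves f calL hX hL hgame hfy hfx);
    move=> L V; rewrite calLE.
- move=> [oL L0] _ LV; exists L; split => //.
  exact: open_horizontally_approaches.
- (* The interior of the closure of L meets L, hence meets V. *)
  move=> [b Lb] oV LV; exists (interior (closure L) `&` V).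
  have oI : open (interior (closure L) `&` V).
    by apply: openI => //; apply: open_interior.
  split => //.
  + have [y [Ly Iy]] : L `&` interior (closure L) !=set0.
      apply: (interior_subset Lb).
      exact: open_nbhs_nbhs (conj (@open_interior _ _) Lb).
    by exists y; split => //; apply: LV.
  + apply: dense_horizontally_approaches => // y [/interior_subset]//.
Qed.
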